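(* (i) For each $n \ge 3$ there exists $k$ such that if a tournament $G$ has no subtournament isomorphic to $K_n$ or $K_n^\ast$, then $G$ can be written as $T_r(H_1,\ldots,H_r)$, where $r \ge 1$ is odd and for each $1\le i\le r$ the tournament $H_i$ has no subtournament isomorphic to $J_k$. (ii) For each $k \ge 3$ there exists $n$ such that if a tournament $G$ can be written as $T_r(H_1,\ldots,H_r)$, where $r\ge1$ is odd and for each $1\le i\le r$ the tournament $H_i$ has no subtournament isomorphic to $J_k$, then $G$ has no subtournament isomorphic to $K_n$ or $K_n^\ast$.
   Context: A tournament is a finite, non-null, loopless directed graph in which for any two distinct vertices $u,v$ there is exactly one edge with both ends in $\{u,v\}$; write $u\to v$ for the edge from $u$ to $v$, and $X\Rightarrow Y$ if $x\to y$ for all $x\in X,y\in Y$. A subtournament is the tournament induced on a nonempty vertex subset. Given an ordering $v_1,\dots,v_n$ of the vertices, a backedge is an edge $v_j\to v_i$ with $j>i$. For $n\ge3$: $J_n$ is the tournament on $v_1,\dots,v_n$ whose only backedge in this ordering is $v_n\to v_1$; $K_n$ is the one whose only backedge is $v_n\to v_2$; $K_n^\ast$ is the one whose only backedge is $v_{n-1}\to v_1$. For $r=2\ell+1$, $T_r$ is the tournament on $t_1,\dots,t_r$ with $t_i\to t_j$ iff $j\equiv i+1,\dots,i+\ell\pmod r$. $T_r(H_1,\dots,H_r)$ denotes a tournament whose vertex set is a disjoint union $V_1\cup\dots\cup V_r$ with the subtournament on $V_i$ isomorphic to $H_i$ and $V_i\Rightarrow V_j$ whenever $t_i\to t_j$.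 *)

(* Defs.v *)
From mathcomp Require Import all_boot.
Set Implicit Arguments. Unset Strict Implicit. Unset Printing Implicit Defensive.

Definition is_tournament (T : finType) (e : rel T) : Prop :=
  0 < #|T| /\
  (forall x, ~~ e x x) /\
  (forall x y, x != y -> e x y != e y x).

(* Tournament on 'I_n (vertices v_1..v_n are 0..n-1) whose only backedge
   w.r.t. the natural ordering is a -> b (with b < a). *)
Definition one_backedge (n a b : nat) : rel 'I_n :=
  fun i j =>
    if (val i == a) && (val j == b) then true
    else if (val i == b) && (val j == a) then false
    else val i < val j.

Definition J_t (n : nat) : rel 'I_n := @one_backedge n (n.-1) 0.
Definition K_t (n : nat) : rel 'I_n := @one_backedge n (n.-1) 1.
Definition Kstar_t (n : nat) : rel 'I_n := @one_backedge n (n.-2) 0.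

Definition contains_in (T : finType) (e : rel T) (A : pred T)
  (k : nat) (H : rel 'I_k) : Prop :=
  exists f : 'I_k -> T, injective f /\ (forall a, A (f a)) /\
    (forall a b, e (f a) (f b) = H a b).

Definition contains (T : finType) (e : rel T) (k : nat) (H : rel 'I_k) : Prop :=
  contains_in e predT H.

(* T_r for r = 2l+1 on t_0..t_{r-1}: t_i -> t_j iff j = i+1..i+l (mod r). *)
Definition Tr_edge (r : nat) (i j : 'I_r) : bool :=
  let d := (val j + r - val i) %% r in (1 <= d) && (d <= r./2).

(* G = T_r(H_1..H_r) with r >= 1 odd and each H_i J_k-free:
   p assigns each vertex its block V_(p x); blocks are nonempty (H_i non-null);
   V_i => V_j whenever t_i -> t_j; the subtournament on each V_i has no
   subtournament isomorphic to J_k. *)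
Definition Tr_decomp_Jfree (T : finType) (e : rel T) (k : nat) : Prop :=
  exists (r : nat) (p : T -> 'I_r),
    odd r /\
    (forall i : 'I_r, exists x, p x = i) /\
    (forall x y, Tr_edge (p x) (p y) -> e x y) /\
    (forall i : 'I_r, ~ contains_in e (fun x => p x == i) (@J_t k)).

(* Main.v *)
(** A tournament is [K_n]- (resp. [K_n^*]-) free iff out-neighbourhoods (resp.
    in-neighbourhoods) of vertices are [J_(n-1)]-free; by Ramsey this bounds by
    [c = 2^n] the number of cyclic triangles through an edge that lie inside
    any one neighbourhood.

    (i) Call two vertices near if they lie in a cyclic triangle contained in
    the out- or in-neighbourhood of some vertex.  All but [O(c)] vertices [h]
    agree on the three vertices of such a triangle, and, if [z] separates two
    of them, all but [O(c)] vertices agree on the triangle and [z].  So if [G]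
    is large some [h] dominates or is dominated by all four, and then [z] is
    near one of the two separated vertices: the components of nearness are
    homogeneous sets.  Merging also pairs of vertices in no common cyclic triangle
    gives homogeneous sets whose quotient is locally transitive with every edge
    in a cyclic triangle, and such a tournament is [T_r].  Finally, if an edge
    [b -> a] had many common [h] with [a -> h -> b] and its ends were connected
    by nearness, then on the way from [a] to [b] the first vertex [x] with more
    than [12 c] in-neighbours among these [h] gives a contradiction; so no
    class contains a long [J_k].

    (ii) In [T_r(H_1, .., H_r)], a cyclic triangle inside the neighbourhood of a
    vertex lies in a single block, hence so does a [J_k]. *)

Require Import Defs.
From mathcomp Require Import all_boot.
From mathcomp Require Import zify.
Set Implicit Arguments. Unset Strict Implicit. Unset Printing Implicit Defensive.

Definition cyc (T : Type) (e : rel T) x y z := [&& e x y, e y z & e z x].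

(** Without the modulus, claims about [Tr_edge] become linear arithmetic. *)
Lemma Tr_edgeE r (i j : 'I_r) :
  Tr_edge i j = if i <= j then 0 < j - i <= r./2 else j + r - i <= r./2.
Proof.
have lti := ltn_ord i; have ltj := ltn_ord j; rewrite /Tr_edge /=.
case: (leqP i j) => ij.
  have -> : j + r - i = j - i + r by lia.
  by rewrite modnDr modn_small //; lia.
by rewrite modn_small; lia.
Qed.

(** * Locally transitive tournaments *)

Section Rotation.

Variables (T : finType) (e : rel T).
Hypothesis tourn : is_tournament e.
Hypothesis loc_out : forall v x y u, e v x -> e v y -> e v u -> ~~ cyc e x y u.
Hypothesis loc_in : forall v x y u, e x v -> e y v -> e u v -> ~~ cyc e x y u.
Hypothesis edge_cyc : forall x y, e x y -> exists z, cyc e x y z.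

Let irr x : e x x = false. Proof. by case: tourn => _ [/(_ x)/negbTE]. Qed.
Let asym x y : x != y -> e y x = ~~ e x y.
Proof. by case: tourn => _ [_ h] /h; case: (e x y); case: (e y x). Qed.
Let nsym x y : e x y -> e y x = false.
Proof.
by case: (eqVneq x y) => [->|/asym ->]; rewrite ?irr // => ->.
Qed.
Let neq x y : e x y -> x != y.
Proof. by apply: contraTneq => ->; rewrite irr. Qed.

Lemma trans_out a x y z : e a x -> e a y -> e a z -> e x y -> e y z -> e x z.
Proof.
move=> ax ay az xy yz; have /negP := loc_out ax ay az; rewrite /cyc xy yz /=.
case: (eqVneq x z) => [xz|/asym -> /negP]; last by rewrite negbK.
by move: yz; rewrite -xz (nsym xy).
Qed.

Lemma trans_in a x y z : e x a -> e y a -> e z a -> e x y -> e y z -> e x z.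
Proof.
move=> ax ay az xy yz; have /negP := loc_in ax ay az; rewrite /cyc xy yz /=.
case: (eqVneq x z) => [xz|/asym -> /negP]; last by rewrite negbK.
by move: yz; rewrite -xz (nsym xy).
Qed.

Let mid x y := [set z | e x z && e z y].
Let d x y := #|mid x y|.+1.
Let outdeg x := #|[set z | e x z]|.

(** From [x] to [y] the out-neighbourhood only trades [y] for [z], the one vertex closing a cyclic
    triangle on [x -> y]. With a second such vertex [w], say [z -> w], a cyclic triangle [z w u]
    would lie in the in-neighbourhood of [x] or, as nothing lies between [x] and [y], in the
    out-neighbourhood of [y]. *)
Lemma outdeg_succ x y : e x y -> mid x y = set0 -> outdeg x = outdeg y.
Proof.
move=> xy m0.
have nm z : e x z -> e z y = false.
  by move=> xz; have := in_set0 z; rewrite -m0 inE xz.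
have [z /and3P[_ yz zx]] := edge_cyc xy.
have outx : [set w | e x w] = y |: [set w | e x w && e y w].
  apply/setP=> w; rewrite !inE; case: (eqVneq w y) => [->|wy] //=.
  case xw: (e x w) => //=; by rewrite asym // nm.
have outy : [set w | e y w] = z |: [set w | e x w && e y w].
  apply/setP=> w; rewrite !inE; case: (eqVneq w z) => [->|wz] //=.
  case yw: (e y w); rewrite ?andbF // andbT.
  case xw: (e x w) => //; exfalso.
  have xNw : x != w by apply: contraTneq yw => <-; rewrite nsym.
  have wx : e w x by rewrite asym // xw.
  wlog zw : z w yz zx wz yw xw xNw wx / e z w.
    move=> H; case zw: (e z w); first by apply: (H z w).
    apply: (H w z) => //; first by rewrite eq_sym.
    - exact: nsym.
    - by rewrite eq_sym neq.
    - by rewrite asym 1?eq_sym // zw.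
  have [u /and3P[_ wu uz]] := edge_cyc zw.
  have ux : x != u by apply: contraTneq uz => <-; rewrite nsym.
  have uy : y != u by apply: contraTneq wu => <-; rewrite nsym.
  case xu: (e x u).
    have yu : e y u by rewrite asym 1?eq_sym // nm.
    by case/negP: (loc_out yz yw yu); rewrite /cyc zw wu uz.
  have {}xu : e u x by rewrite asym // xu.
  by case/negP: (loc_in zx wx xu); rewrite /cyc zw wu uz.
rewrite /outdeg outx outy !cardsU1 !inE irr !andbF.
by rewrite (nsym zx).
Qed.

(** Induction on the number of vertices between [x] and [y]: by local transitivity, splitting at
    such a vertex [z] leaves fewer of them on either side. *)
Lemma outdeg_edge x y : e x y -> outdeg x = outdeg y.
Proof.
move: {2}(d x y) (leqnn (d x y)) => m; elim: m x y => // m IH x y; rewrite ltnS => lem xy.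
have [m0|[z]] := set_0Vmem (mid x y); first exact: outdeg_succ.
rewrite inE => /andP[xz zy]; rewrite (IH x z) ?(IH z y) //.
  apply: leq_trans lem; apply: proper_card; apply/properP; split.
    apply/subsetP=> w; rewrite !inE => /andP[zw wy]; rewrite wy andbT.
    exact: (trans_in xy zy wy xz zw).
  by exists z; rewrite !inE ?irr ?andbF ?xz.
apply: leq_trans lem; apply: proper_card; apply/properP; split.
  apply/subsetP=> w; rewrite !inE => /andP[xw wz]; rewrite xw /=.
  exact: (trans_out xw xz xy wz zy).
by exists z; rewrite !inE ?irr ?andbF ?xz.
Qed.

Lemma outdeg_const x y : outdeg x = outdeg y.
Proof.
case: (eqVneq x y) => [->|/asym]; first by [].
by case xy: (e x y); [rewrite (outdeg_edge xy) | move/outdeg_edge].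
Qed.

(** Out-degrees are constant and have the same sum as in-degrees, so every in-degree is [outdeg q]
    too. *)
Lemma card_regular q : #|T| = (outdeg q).*2.+1.
Proof.
have deg x : #|T| = outdeg x + #|[set z | e z x]| + 1.
  rewrite -cardsT (_ : setT = [set z | e x z] :|: [set z | e z x] :|: [set x]); last first.
    apply/setP=> z; rewrite !inE; case: (eqVneq x z) => [->|/asym ->]; rewrite ?eqxx ?orbT //.
    by rewrite orbN.
  rewrite cardsU cards1 (_ : _ :&: [set x] = set0) ?cards0 ?subn0; last first.
    by apply/setP=> z; rewrite !inE andbC; case: eqP => // ->; rewrite irr.
  rewrite cardsU (_ : _ :&: [set z | e z x] = set0) ?cards0 ?subn0 //.
  by apply/setP=> z; rewrite !inE; case xz: (e x z) => //=; rewrite nsym.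
have : \sum_x outdeg x = \sum_x #|[set z | e z x]|.
  have E (r : rel T) x : #|[set z | r x z]| = \sum_z r x z.
    by rewrite -sum1dep_card big_mkcond; apply: eq_bigr => z _; case: (r x z).
  rewrite (eq_bigr _ (fun x _ => E e x)).
  by rewrite (eq_bigr _ (fun x _ => E (fun x z => e z x) x)) exchange_big.
rewrite (eq_bigr (fun=> outdeg q)); last by move=> x _; exact: outdeg_const.
rewrite [RHS](eq_bigr (fun=> #|T| - outdeg q - 1)); last first.
  by move=> x _; rewrite {1}(deg x) (outdeg_const q x); lia.
rewrite !sum_nat_const => /eqP; rewrite eqn_mul2l; have := deg q.
case: tourn => T0 _; rewrite eqn0Ngt T0 /= => dq /eqP. lia.
Qed.

Lemma d_le x y : e x y -> d x y <= outdeg x.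
Proof.
move=> xy; apply: proper_card; apply/properP; split.
  by apply/subsetP=> z; rewrite !inE => /andP[].
by exists y; rewrite inE // irr andbF.
Qed.

(* [d x y] is the forward distance from [x] to [y] on the circle; the next two
   lemmas make it additive modulo [#|T|]. *)
Lemma d_trans a b c : e a b -> e b c -> e a c -> d a c = d a b + d b c.
Proof.
move=> ab bc ac; rewrite /d.
have -> : mid a c = b |: (mid a b :|: mid b c).
  apply/setP=> z; rewrite !inE; case: (eqVneq z b) => [->|zb] /=; first by rewrite ab.
  apply/andP/orP => [[az zc]|].
    case zb': (e z b); first by left; rewrite az.
    by right; rewrite zc asym // zb'.
  case=> /andP[h1 h2]; split=> //; first exact: (trans_out h1 ab ac h2 bc).
  exact: (trans_in ac bc h2 ab h1).
rewrite cardsU1 cardsU (_ : _ :&: _ = set0) ?cards0; last first.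
  by apply/setP=> z; rewrite !inE; case zb: (e z b); rewrite ?andbF // (nsym zb) andbF.
rewrite !inE irr andbF /=; lia.
Qed.

Lemma d_cyc a b c : cyc e a b c -> d a b + d b c + d c a = #|T|.
Proof.
case/and3P=> ab bc ca; rewrite /d.
have [nab nbc nca] := And3 (nsym ab) (nsym bc) (nsym ca).
rewrite -cardsT (_ : setT = [set a; b; c] :|: (mid a b :|: mid b c :|: mid c a)); last first.
  apply/setP=> z; rewrite !inE; case: (eqVneq z a) => //= za; case: (eqVneq z b) => //= zb.
  case: (eqVneq z c) => //= zc.
  case ez1: (e z a); case ez2: (e z b); case ez3: (e z c);
    rewrite (asym za) (asym zb) (asym zc) ez1 ez2 ez3 //.
    by case/negP: (loc_out ez1 ez2 ez3); rewrite /cyc ab bc ca.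
  move: (asym za) (asym zb) (asym zc); rewrite ez1 ez2 ez3 /= => az bz cz.
  by case/negP: (loc_in az bz cz); rewrite /cyc ab bc ca.
have D (A B : {set T}) : (forall z, z \in A -> z \in B -> false) -> #|A :|: B| = #|A| + #|B|.
  move=> AB; rewrite cardsU (_ : A :&: B = set0) ?cards0 ?subn0 //.
  by apply/setP=> z; rewrite !inE; apply/negP=> /andP[/AB h /h].
rewrite D; last first.
  move=> z; rewrite !inE -orbA => /or3P[]/eqP->; by rewrite !irr ?nab ?nbc ?nca ?andbF.
rewrite (D (_ :|: mid b c)); last first.
  move=> z; rewrite !inE => /orP[]/andP[h1 h2] /andP[h3 h4]; move: (nsym h1) (nsym h2);
  by rewrite ?h3 ?h4.
rewrite (D (mid a b) (mid b c)); last first.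
  by move=> z; rewrite !inE => /andP[h1 h2] /andP[h3 h4]; move: (nsym h2); rewrite h3.
rewrite -setUA !cardsU1 cards1 !inE /=.
have := neq ab; have := neq bc; have := neq ca.
rewrite (eq_sym c a) => /negbTE-> /negbTE-> /negbTE->; lia.
Qed.

Lemma rotation_structure :
  odd #|T| /\ exists pos : T -> 'I_#|T|,
    bijective pos /\ forall x y, Tr_edge (pos x) (pos y) = e x y.
Proof.
have T0 : 0 < #|T| by case: tourn.
have [q _] : exists q : T, q \in T by apply/card_gt0P.
have rE := card_regular q; set r := #|T| in rE *.
have lE x : outdeg x = r./2 by rewrite rE (outdeg_const x q); lia.
split; first by rewrite rE /= odd_double.
have dl x y : e x y -> 0 < d x y <= r./2 by move=> xy; rewrite -(lE x) d_le.
(* Forward distance from the base point [q]; for [y -> q] it is what the way from [y] to [q] leaves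
   of the full turn. *)
pose pn y := if y == q then 0 else if e q y then d q y else r - d y q.
have pnr y : pn y < r.
  rewrite /pn; case: eqP => // /eqP yq; case qy: (e q y).
    by have := dl _ _ qy; lia.
  have yq' : e y q by rewrite asym 1?eq_sym // qy.
  by have := dl _ _ yq'; lia.
pose pos y := Ordinal (pnr y).
(* The second alternative occurs when the step from [x] to [y] reaches or passes [q]. *)
have step x y : e x y -> pn x + d x y = pn y \/ pn x + d x y = pn y + r.
  move=> xy; rewrite /pn; have := dl _ _ xy; case: (eqVneq x q) => [xq|xq].
    by rewrite -xq eq_sym (negbTE (neq xy)) xy; left.
  case: (eqVneq y q) => [yq|yq].
    by rewrite -yq (nsym xy); lia.
  have := asym xq; have := asym yq.
  case xq': (e x q); case yq': (e y q) => /= -> ->; have := dl x q; have := dl y q; rewrite ?xq' ?yq'.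
  - by have := d_trans xy yq' xq'; lia.
  - have qy : e q y by rewrite asym // yq'.
    by have := d_trans xq' qy xy; lia.
  - have qx : e q x by rewrite asym // xq'.
    have C : cyc e q x y by rewrite /cyc qx xy yq'.
    by have := d_cyc C; lia.
  have qx : e q x by rewrite asym // xq'.
  have qy : e q y by rewrite asym // yq'.
  by have := d_trans qx xy qy; lia.
have posE x y : Tr_edge (pos x) (pos y) = e x y.
  have := pnr x; have := pnr y; rewrite Tr_edgeE /=.
  case: (eqVneq x y) => [->|xy]; first by rewrite irr leqnn subnn.
  case exy: (e x y); first by have := step _ _ exy; have := dl _ _ exy; case: (leqP (pn x) (pn y)); lia.
  have eyx : e y x by rewrite asym // exy.
  by have := step _ _ eyx; have := dl _ _ eyx; case: (leqP (pn x) (pn y)); lia.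
exists pos; split=> //; apply: inj_card_bij; last by rewrite card_ord.
move=> x y pxy; apply/eqP; apply: contraT => xy.
have := asym xy; rewrite -(posE x y) -(posE y x) pxy Tr_edgeE leqnn subnn; lia.
Qed.

End Rotation.
(** * Triangles inside neighbourhoods *)

(** Local transitivity up to [c] exceptions per edge: [h] closes a cyclic triangle on [p -> q] among
    the out-neighbours of [t]. *)
Definition few_out (T : finType) (e : rel T) (c : nat) : Prop :=
  forall t p q, e p q -> e t p -> e t q ->
    #|[set h | [&& e q h, e h p & e t h]]| <= c.

Definition few_in (T : finType) (e : rel T) (c : nat) : Prop :=
  forall t p q, e p q -> e p t -> e q t ->
    #|[set h | [&& e q h, e h p & e h t]]| <= c.

Definition rev_rel (T : Type) (e : rel T) : rel T := fun x y => e y x.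

Lemma few_out_rev (T : finType) (e : rel T) c : few_in e c -> few_out (rev_rel e) c.
Proof.
move=> h t p q qp pt qt; apply: leq_trans (h t q p qp qt pt).
by apply/eq_leq/eq_card=> w; rewrite !inE andbCA.
Qed.

Lemma few_in_rev (T : finType) (e : rel T) c : few_out e c -> few_in (rev_rel e) c.
Proof.
move=> h t p q qp pt qt; apply: leq_trans (h t q p qp qt pt).
by apply/eq_leq/eq_card=> w; rewrite !inE andbCA.
Qed.

Lemma is_tournament_rev (T : finType) (e : rel T) :
  is_tournament e -> is_tournament (rev_rel e).
Proof. by case=> T0 [irr as_e]; do !split=> //; move=> x y xy; apply: as_e; rewrite eq_sym. Qed.

Lemma tourn_irr (T : finType) (e : rel T) : is_tournament e -> forall x, e x x = false.
Proof. by case=> _ [irr _] x; apply: negbTE. Qed.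

Lemma tourn_asym (T : finType) (e : rel T) :
  is_tournament e -> forall x y, x != y -> e y x = ~~ e x y.
Proof. by case=> _ [_ h] x y /h; case: (e x y); case: (e y x). Qed.

Lemma tourn_edge (T : finType) (e : rel T) :
  is_tournament e -> forall x y, e x y -> (x != y) * (e y x = false).
Proof.
move=> te x y; case: (eqVneq x y) => [->|xy]; first by rewrite tourn_irr.
by move=> exy; rewrite (tourn_asym te xy) exy.
Qed.

Lemma card_cover_le (T : finType) c (s : seq {set T}) (A : {set T}) :
  (forall x, x \in A -> has (fun B : {set T} => x \in B) s) ->
  (forall B : {set T}, B \in s -> #|B| <= c) -> #|A| <= size s * c.
Proof.
elim: s A => [|B s IH] A sub le /=.
  by rewrite leqn0 cards_eq0; apply/eqP/setP=> x; rewrite inE; apply/negP=> /sub.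
rewrite mulSn -(cardsID B A); apply: leq_add.
  by apply: leq_trans (le B (mem_head _ _)); rewrite subset_leq_card ?subsetIr.
apply: IH => [x|B' B's]; last by apply: le; rewrite inE B's orbT.
by rewrite inE => /andP[xB /sub] /=; rewrite (negbTE xB).
Qed.

Definition splits (T : Type) (e : rel T) h x y u :=
  ~~ ((e h x == e h y) && (e h x == e h u)).

Definition ltri (T : finType) (e : rel T) x y u := cyc e x y u &&
  [exists v, [&& e v x, e v y & e v u] || [&& e x v, e y v & e u v]].

Definition near (T : finType) (e : rel T) : rel T :=
  fun x y => [exists u, ltri e x y u || ltri e y x u].

(* If [h] splits the triangle then it has an edge [p -> q] with [q -> h -> p] and
   an edge [r -> s] with [r -> h -> s].  If [v -> h], count [h] over [p -> q] inside
   the out-neighbourhood of [v]; if [h -> v], over [v -> r] inside the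
   in-neighbourhood of [s]. *)
Lemma ltri_sep_out (T : finType) (e : rel T) c v x y u :
  is_tournament e -> 0 < c -> few_out e c -> few_in e c -> cyc e x y u ->
  e v x -> e v y -> e v u ->
  #|[set h | (h \in [:: x; y; u]) || splits e h x y u]| <= 9 * c.
Proof.
move=> te c0 fo fi /and3P[xy yu ux] vx vy vu.
pose O p q := [set h | [&& e q h, e h p & e v h]].
pose I r s := [set h | [&& e r h, e h v & e h s]].
apply: (@card_cover_le _ c [:: [set x]; [set y]; [set u]; O x y; O y u; O u x;
                               I x y; I y u; I u x]); last first.
  move=> B; rewrite !inE => /or4P[||| /or4P[||| /or3P[]]] /eqP->; rewrite ?cards1 //;
  by [apply: fo | apply: fi].
move=> h; rewrite /O /I !inE /= !inE; case: (eqVneq h x) => //= hx.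
case: (eqVneq h y) => //= hy; case: (eqVneq h u) => //= hu.
case: (eqVneq h v) => [->|hv]; first by rewrite /splits vx vy vu.
rewrite /splits (tourn_asym te hx) (tourn_asym te hy) (tourn_asym te hu).
rewrite (tourn_asym te hv).
by case: (e h x); case: (e h y); case: (e h u); case: (e h v); rewrite ?orbT.
Qed.

Lemma ltri_rot (T : finType) (e : rel T) x y u : ltri e x y u = ltri e y u x.
Proof.
rewrite /ltri /cyc; congr andb; first by rewrite andbC -andbA.
by apply: eq_existsb => v; congr orb; rewrite andbC -andbA.
Qed.

Lemma ltri_near (T : finType) (e : rel T) x y u : ltri e x y u -> near e x y.
Proof. by move=> h; apply/existsP; exists u; rewrite h. Qed.

Lemma near_sym (T : finType) (e : rel T) x y : near e x y = near e y x.
Proof. by apply: eq_existsb => u; rewrite orbC. Qed.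

(** * Vertices separating a near pair *)

Section Near.

Variables (T : finType) (e : rel T) (c : nat).
Hypotheses (te : is_tournament e) (c0 : 0 < c) (fo : few_out e c) (fi : few_in e c).

(** Reversing all edges turns in-neighbourhoods into out-neighbourhoods and exchanges the two
    bounds. *)
Lemma ltri_sep x y u : ltri e x y u ->
  #|[set h | (h \in [:: x; y; u]) || splits e h x y u]| <= 9 * c.
Proof.
case/andP=> C /existsP[v /orP[] /and3P[xv yv uv]].
  exact: ltri_sep_out fi C xv yv uv.
have C' : cyc (rev_rel e) y x u by case/and3P: C => *; apply/and3P.
apply: leq_trans (ltri_sep_out (is_tournament_rev te) c0 (few_out_rev fi) (few_in_rev fo)
  C' yv xv uv); apply/subset_leq_card/subsetP=> h; rewrite !inE /splits /rev_rel.
case: (eqVneq h x) => [|hx]; rewrite ?orbT //; case: (eqVneq h y) => //= hy.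
case: (eqVneq h u) => //= hu; rewrite (tourn_asym te hx) (tourn_asym te hy) (tourn_asym te hu).
by case: (e h x); case: (e h y); case: (e h u).
Qed.

Lemma near_sep x y : near e x y -> #|[set h | e h x != e h y]| <= 9 * c.
Proof.
case/existsP=> u /orP[] /ltri_sep; apply: leq_trans;
  apply/subset_leq_card/subsetP=> h; rewrite !inE /splits => hxy.
  by rewrite (negbTE hxy) orbT.
by rewrite (eq_sym (e h y)) (negbTE hxy) orbT.
Qed.

Lemma ltri_sep4 x y u z : ltri e x y u -> z \notin [:: x; y; u] -> splits e z x y u ->
  #|[set h | [|| h \in [:: x; y; u], splits e h x y u | e h x != e h z]]| <= 12 * c.
Proof.
move=> L; have := L; case/andP=> /and3P[xy yu ux] _.
rewrite !inE !negb_or => /and3P[zx zy zu] zs.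
(* A vertex [h] uniform on the triangle but disagreeing on [z] closes a cyclic
     triangle either on [r -> z], all dominating [s], or on [z -> s], all
     dominated by [r]. *)
have aux r s : r \in [:: x; y; u] -> s \in [:: x; y; u] -> e r s -> e r z -> e z s ->
  #|[set h | [|| h \in [:: x; y; u], splits e h x y u | e h x != e h z]]| <= 12 * c.
  move=> rm sm rs rz zs'; rewrite (_ : 12 * c = 9 * c + 3 * c); last by rewrite -mulnDl.
  rewrite -(cardsID [set h | (h \in [:: x; y; u]) || splits e h x y u]); apply: leq_add.
    by apply: leq_trans (ltri_sep L); rewrite subset_leq_card ?subsetIr.
  apply: (@card_cover_le _ c [:: [set z]; [set h | [&& e z h, e h r & e h s]];
      [set h | [&& e s h, e h z & e r h]]]); last first.
    by move=> B; rewrite !inE => /or3P[] /eqP->; rewrite ?cards1 //; [apply: fi | apply: fo].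
  move=> h; rewrite 3!inE negb_or => /andP[/andP[hm hs]].
  rewrite (negbTE hm) (negbTE hs) /= => hz; rewrite !inE.
  case: (eqVneq h z) => //= hz'.
  have [hr hs'] : h != r /\ h != s by split; apply: contraNneq hm => ->.
  move: hs; rewrite /splits negbK => /andP[/eqP hxy /eqP hxu].
  have hE w : w \in [:: x; y; u] -> e h w = e h x.
    by rewrite !inE => /or3P[] /eqP->.
  rewrite (tourn_asym te hz') (tourn_asym te hr) (tourn_asym te hs') (hE r) // (hE s) //.
  by move: hz; case: (e h x); case: (e h z).
(* Going round the triangle, the direction towards [z] changes, so some edge [r -> s] of it has
   [r -> z -> s]. *)
move: zs; rewrite /splits.
have := aux x y; have := aux y u; have := aux u x; rewrite !inE !eqxx ?orbT => a1 a2 a3.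
move: (tourn_asym te zx) (tourn_asym te zy) (tourn_asym te zu).
case zx': (e z x); case zy': (e z y); case zu': (e z u) => //= xz yz uz _; auto.
Qed.

(** Either [z] is the third vertex of the triangle and hence near [x], or it splits the triangle
    from outside. *)
Lemma near_sep4 x y z : near e x y -> z != x -> z != y -> e z x != e z y ->
  #|[set h | e h x != e h z]| <= 12 * c.
Proof.
case/existsP=> u L zx zy zxy.
case: (eqVneq z u) L => [->|zu].
  rewrite ltri_rot => L; suff : near e x u.
    by move/near_sep/leq_trans; apply; rewrite leq_mul2r orbT.
  case/orP: L => [|]; first by rewrite ltri_rot near_sym; exact: ltri_near.
  by rewrite ltri_rot; apply: ltri_near.
case/orP=> L; have := ltri_sep4 L.
  move/(_ z); rewrite !inE !negb_or zx zy zu {1}/splits (negbTE zxy) => /(_ isT isT).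
  apply: leq_trans; apply/subset_leq_card/subsetP=> h; rewrite !inE => ->.
  by rewrite !orbT.
move/(_ z); rewrite !inE !negb_or zx zy zu {1}/splits eq_sym (negbTE zxy) => /(_ isT isT).
apply: leq_trans; apply/subset_leq_card/subsetP=> h; rewrite !inE /splits => hxz.
case: (eqVneq (e h y) (e h x)) => [->|_]; last by rewrite orbT.
by rewrite hxz !orbT.
Qed.

(** Some [h] escapes the [12 * c] exceptions, so [x], [y], [u], [z] lie on one side of it and every
    cyclic triangle among them is an [ltri]. *)
Lemma near_split x y z : 12 * c < #|T| ->
  near e x y -> z != x -> z != y -> e z x != e z y -> near e z x || near e z y.
Proof.
move=> big /existsP[u L0].
wlog L : x y L0 / ltri e x y u.
  move=> H zx zy zxy; case/orP: L0 => L; first by apply: H; rewrite ?L.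
  by rewrite orbC; apply: H; rewrite ?L // eq_sym.
move=> zx zy zxy; case: (eqVneq z u) => [->|zu].
  by move: L; rewrite -ltri_rot => /ltri_near ->.
have zs : splits e z x y u by rewrite /splits (negbTE zxy).
have zm : z \notin [:: x; y; u] by rewrite !inE !negb_or zx zy.
have {big}/existsP[h] : [exists h, h \notin
    [set h | [|| h \in [:: x; y; u], splits e h x y u | e h x != e h z]]].
  rewrite -negb_forall; apply/negP => /forallP all_h.
  have := leq_trans big (leqnn _); rewrite ltnNge; case/negP.
  apply: leq_trans (ltri_sep4 L zm zs); apply/subset_leq_card/subsetP => h _; exact: all_h.
rewrite inE 2!negb_or negbK /splits negbK => /and3P[hm /andP[/eqP hxy /eqP hxu] /eqP hxz].
have hE w : w \in [:: x; y; u; z] -> e h w = e h x.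
  by rewrite !inE => /or4P[] /eqP->.
have hz : h \notin [:: x; y; u; z].
  rewrite (_ : [:: x; y; u; z] = rcons [:: x; y; u] z) // mem_rcons in_cons negb_or hm andbT.
  by apply: contraNneq zs => hz; rewrite /splits -hz -hxy -hxu eqxx.
have N p q w : p \in [:: x; y; u; z] -> q \in [:: x; y; u; z] -> w \in [:: x; y; u; z] ->
    cyc e p q w -> ltri e p q w.
  move=> pm qm wm C; rewrite /ltri C; apply/existsP; exists h.
  have D t : t \in [:: x; y; u; z] -> e t h = ~~ e h x.
    by move=> tm; rewrite (@tourn_asym _ _ te h) ?hE //; apply: contraNneq hz => ->.
  by rewrite !hE // !D //; case: (e h x).
have := L; case/andP=> /and3P[xy yu ux] _.
have [yz xz uz] := And3 (tourn_asym te zy) (tourn_asym te zx) (tourn_asym te zu).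
(* If [z -> x], the triangle is [z x y]; if [x -> z -> y], it is [x z u] or [z y u], by the edge
   between [z] and [u]. *)
case zx': (e z x) zxy xz => zxy xz.
  have zy' : e z y = false by move: zxy; case: (e z y).
  suff /ltri_near -> : ltri e z x y by [].
  by apply: N; rewrite ?inE ?eqxx ?orbT // /cyc zx' xy yz zy'.
have zy' : e z y by move: zxy; case: (e z y).
case zu': (e z u) uz => /= uz.
  suff : ltri e x z u by move/ltri_near; rewrite near_sym => ->.
  by apply: N; rewrite ?inE ?eqxx ?orbT // /cyc xz zu' ux.
suff /ltri_near -> : ltri e z y u by rewrite orbT.
by apply: N; rewrite ?inE ?eqxx ?orbT // /cyc zy' yu uz.
Qed.

End Near.
(** * Homogeneous classes *)

Lemma connect_exit (T : finType) (r : rel T) (S : {set T}) a b :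
  connect r a b -> a \in S -> b \notin S ->
  exists x y, [/\ r x y, x \in S & y \notin S].
Proof.
case/connectP=> p; elim: p a => [|y p IH] a /=; first by move=> _ -> ->.
case/andP=> ay yp lb aS; case: (boolP (y \in S)) => [yS|yS _]; first exact: IH lb yS.
by exists a, y.
Qed.

(** In the quotient, the first disjunct yields local transitivity, the second a cyclic triangle on
    every edge. *)
Definition twin (T : finType) (e : rel T) : rel T := fun x y =>
  connect (near e) x y || [forall z, ~~ cyc e x y z && ~~ cyc e y x z].

Section Classes.

Variables (T : finType) (e : rel T) (c : nat).
Hypotheses (te : is_tournament e) (c0 : 0 < c) (fo : few_out e c) (fi : few_in e c).
Hypothesis big : 12 * c < #|T|.

Let conn := connect (near e).
Let asym := tourn_asym te.
Let irr := tourn_irr te.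

Let conn_sym x y : conn x y = conn y x.
Proof. exact/sym_connect_sym/near_sym. Qed.

(** A vertex separating two consecutive vertices of a path of near pairs is near one of them, hence
    in their component. *)
Lemma conn_module x y z : conn x y -> ~~ conn x z -> e z x = e z y.
Proof.
case/connectP=> p; elim: p x => [|w p IH] x /=; first by move=> _ ->.
case/andP=> xw wp yE xz; have cxw : conn x w by apply: connect1.
have wz : ~~ conn w z by apply: contra xz; apply: connect_trans.
rewrite -(IH w) //; apply/eqP; apply: contraT => zxw.
have zx : z != x by apply: contraNneq xz => ->; apply: connect0.
have zw : z != w by apply: contraNneq wz => ->; apply: connect0.
case/orP: (near_split te c0 fo fi big xw zx zw zxw) => /connect1; rewrite -/conn conn_sym.
  by rewrite (negbTE xz).
by rewrite (negbTE wz).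
Qed.

Lemma conn_edge a b : e b a -> conn a b -> #|[set h | e a h && e h b]| <= 36 * c.
Proof.
move=> ba cab; set W := [set h | _]; rewrite leqNgt; apply/negP => bigW.
pose Win x := [set w in W | e w x].
(* The path from [a] to [b] leaves [S] at a near pair [y], [x]; as [b -> x] will still hold, it is
   the count that fails at [x]. *)
pose S := [set x | e b x && (#|Win x| <= 12 * c)].
have aS : a \in S.
  rewrite inE ba (_ : Win a = set0) ?cards0 //; apply/setP=> w; rewrite !inE.
  by case aw: (e a w) => //=; rewrite (tourn_edge te aw) andbF.
have bS : b \notin S by rewrite inE irr.
have [y [x [yx yS xS]]] := connect_exit cab aS bS.
move: yS; rewrite inE => /andP[yb yW].
(* [b] is dominated by all of [W], hence cannot agree with [y] almost everywhere. *)
have b_close z : #|[set h | e h y != e h z]| <= 12 * c -> z != b.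
  move=> zc; apply: contraL bigW => /eqP zb; rewrite -leqNgt.
  rewrite -(cardsID [set w | e w y] W).
  apply: (@leq_trans (12 * c + 12 * c)); last by rewrite -mulnDl leq_mul2r orbT.
  apply: leq_add.
    by apply: leq_trans yW; apply/subset_leq_card/subsetP=> w; rewrite !inE.
  apply: leq_trans zc; apply/subset_leq_card/subsetP=> w; rewrite !inE zb.
  by case/andP=> /negbTE -> /andP[_ ->].
have xb : x != b.
  by apply: b_close; apply: leq_trans (near_sep te c0 fo fi yx) _; rewrite leq_mul2r orbT.
(* Otherwise [b] separates [y] from [x] and so agrees with [y] almost everywhere. *)
have bx : e b x.
  apply: contraT => bx; suff : b != b by rewrite eqxx.
  apply/b_close/(near_sep4 te c0 fo fi yx); rewrite ?(eq_sym b x) //; first by rewrite (tourn_edge te yb).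
  by rewrite yb (negbTE bx).
move: xS; rewrite inE bx /= -ltnNge => xW.
(* [w] separates the near pair [x], [y], so [x] and [w] agree almost everywhere;
   but then [w1 -> w -> h] makes [h] close the edge [b -> x] inside the
   out-neighbourhood of [w1], for almost all [h] in [W]. *)
have [w ww wy] : exists2 w, w \in Win x & w \notin Win y.
  apply/subsetPn; apply/negP => /subset_leq_card; rewrite leqNgt.
  by rewrite (leq_ltn_trans yW xW).
move: ww; rewrite inE => /andP[wW wx]; move: wy; rewrite inE wW /= => wy.
have wb : e w b by move: wW; rewrite inE => /andP[].
have aw : e a w by move: wW; rewrite inE => /andP[].
have sxw : #|[set h | e h x != e h w]| <= 12 * c.
  apply: (near_sep4 te c0 fo fi (y := y)); first by rewrite near_sym.
  - by rewrite (tourn_edge te wx).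
  - by apply: contraTneq yb => <-; rewrite (tourn_edge te wb).
  - by rewrite wx (negbTE wy).
have {xW} [w1 w1x w1w] : exists2 w1, w1 \in Win x & e w1 w.
  have /subsetPn[w1 w1x] : ~~ (Win x \subset [set h | e h x != e h w]).
    by apply/negP => /subset_leq_card; rewrite leqNgt (leq_ltn_trans sxw xW).
  rewrite inE negbK => /eqP w1E; exists w1; rewrite // -w1E.
  by move: w1x; rewrite inE => /andP[].
move: w1x; rewrite !inE => /andP[/andP[aw1 w1b] w1x].
have := bigW; rewrite ltnNge; case/negP.
(* The [36 * c] are [12 * c] for disagreement of [x] and [w], [12 * c] for [h -> y], [9 * c] for
   [h -> x] without [h -> y], and [3 * c] for the rest. *)
apply: leq_trans (_ : #|W| <= 12 * c + 24 * c) _; last by rewrite -mulnDl.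
rewrite -(cardsID [set h | e h x != e h w] W); apply: leq_add.
  by apply: leq_trans sxw; rewrite subset_leq_card ?subsetIr.
rewrite -(cardsID [set h | e h x] (W :\: _)) (_ : 24 * c = 21 * c + 3 * c); last by rewrite -mulnDl.
apply: leq_add.
  rewrite (_ : 21 * c = 12 * c + 9 * c); last by rewrite -mulnDl.
  rewrite -(cardsID [set h | e h y]); apply: leq_add.
    apply: leq_trans yW; apply/subset_leq_card/subsetP=> h; rewrite !inE.
    by case/andP=> /andP[/andP[_ ->]].
  apply: leq_trans (near_sep te c0 fo fi yx); apply/subset_leq_card/subsetP=> h.
  by rewrite !inE => /andP[/negbTE -> /andP[_ ->]].
apply: (@card_cover_le _ c [:: [set w]; [set h | [&& e x h, e h b & e w1 h]];
   [set h | [&& e w h, e h w1 & e a h]]]).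
  move=> h; rewrite !inE negbK /= !inE => /and3P[hx /eqP hxw /andP[ah hb]].
  case: (eqVneq h w) => //= hw; rewrite ah hb /=.
  have hx' : h != x by apply: contraTneq bx => <-; rewrite (tourn_edge te hb).
  have hw1 : h != w1 by apply: contraNneq hx => ->.
  rewrite (asym hx') (asym hw) -hxw (negbTE hx) /= (asym hw1).
  by case: (e h w1).
move=> B; rewrite !inE => /or3P[] /eqP->; rewrite ?cards1 //; exact: fo.
Qed.

Lemma twin_refl x : twin e x x.
Proof. by rewrite /twin connect0. Qed.

Lemma twin_sym x y : twin e x y = twin e y x.
Proof.
rewrite /twin -/conn conn_sym; congr orb; apply: eq_forallb => z.
by rewrite andbC.
Qed.

Lemma ltri_conn x y u v : cyc e x y u ->
  [&& e v x, e v y & e v u] || [&& e x v, e y v & e u v] -> conn x y.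
Proof.
move=> C V; apply/connect1/(@ltri_near _ _ _ _ u).
by rewrite /ltri C; apply/existsP; exists v.
Qed.

(** The case of two pairs in no cyclic triangle: going round a cyclic triangle on [x], [z], the
    direction towards [y] cannot change, so [y] has the triangle in a neighbourhood and [x] is near
    [z]. *)
Lemma twin_trans y x z : twin e x y -> twin e y z -> twin e x z.
Proof.
have conn_twin x1 y1 z1 : conn x1 y1 -> twin e y1 z1 -> twin e x1 z1.
  move=> xy /orP[yz|/forallP yz]; first by rewrite /twin (connect_trans xy yz).
  rewrite /twin; case: (boolP (connect _ _ _)) => //= xz; apply/forallP=> t.
  have E w : ~~ conn x1 w -> (e w x1 = e w y1) * (e x1 w = e y1 w).
    move=> xw; have ew := conn_module xy xw; split=> //.
    have wx : w != x1 by apply: contraNneq xw => ->; apply: connect0.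
    have wy : w != y1 by apply: contraNneq xw => ->.
    by rewrite (asym wx) (asym wy) ew.
  (* If [t] is in the component of [x1], then [z1] sees both alike; otherwise the triangle can be
     moved from [x1] to [y1]. *)
  case: (boolP (conn x1 t)) => [xt|xt]; last first.
    by have := yz t; rewrite /cyc !(E z1) // !(E t).
  have := conn_module xt xz; have := E z1 xz.
  have zx : z1 != x1 by apply: contraNneq xz => ->; apply: connect0.
  have zt : z1 != t by apply: contraNneq xz => ->.
  rewrite /cyc (asym zx) (asym zt) => _ ->.
  by case: (e z1 t); rewrite ?andbF.
case/orP=> [/conn_twin h|xy]; first exact: h.
case/orP=> [yz|yz].
  rewrite twin_sym; apply: (conn_twin _ y); first by rewrite conn_sym.
  by rewrite twin_sym /twin xy orbT.
rewrite /twin; case: (boolP (connect _ _ _)) => //= xz; apply/forallP=> t.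
have aux x1 z1 : (forall w, ~~ cyc e x1 y w && ~~ cyc e y x1 w) ->
    (forall w, ~~ cyc e z1 y w && ~~ cyc e y z1 w) -> ~~ conn x1 z1 -> ~~ cyc e x1 z1 t.
  move=> {}xy {}yz {}xz; apply/negP => C; have := C; case/and3P=> exz ezt etx.
  have yx : y != x1 by apply: contraTneq C => <-; have /andP[] := yz t.
  have yz' : y != z1 by apply: contraTneq C => <-; have /andP[] := xy t.
  have yt : y != t.
    apply: contraTneq C => <-; have /andP[_] := xy z1; rewrite /cyc.
    by case: (e x1 z1); case: (e z1 y); case: (e y x1).
  case/negP: xz; apply: (@ltri_conn _ _ t y) => //.
  have /andP[_] := xy z1; have /andP[+ _] := xy t; have /andP[_] := yz t.
  rewrite /cyc exz ezt etx (asym yx) (asym yz') (asym yt).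
  by case: (e y x1); case: (e y z1); case: (e y t).
apply/andP; split; apply: aux.
- exact/forallP.
- by move=> w; rewrite andbC (forallP yz).
- exact: xz.
- by move=> w; rewrite andbC (forallP yz).
- exact/forallP.
- by rewrite conn_sym.
Qed.

(** For [x], [y] in no cyclic triangle and [z] separating them, take a cyclic triangle on [x], [z]
    with third vertex [t]. Neither [z] nor [t] closes a triangle on [x], [y], which puts [x], [z],
    [t] on one side of [y] and makes [x] near [z]. *)
Lemma twin_module x y z : twin e x y -> ~~ twin e x z -> e z x = e z y.
Proof.
move=> xy xz; have zy : z != y by apply: contraNneq xz => ->.
move: xy xz; rewrite /twin -/conn negb_or => /orP[xy|/forallP xy] /andP[xz].
  by move=> _; apply: conn_module.
have zx : z != x by apply: contraNneq xz => ->; apply: connect0.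
case: (eqVneq y x) => [->|yx] //.
case/forallPn => t; rewrite -negb_or negbK => C; apply/eqP; apply: contraT => E.
move: (xy z) (xy t) C; rewrite /cyc (asym zx) (asym zy) (asym yx) => xyz xyt C.
case/negP: xz.
have tN : t != y.
  apply: contraTneq C => ->; rewrite (asym zy) (asym yx).
  by move: xyz E; case: (e z x); case: (e z y); case: (e y x).
move: xyt xyz C E; rewrite (asym tN).
case ezx: (e z x); case ezy: (e z y); case eyx: (e y x) => //=; rewrite ?orbF ?andbT.
- case/nandP => [h|h] _ /andP[h1 h2]; first by rewrite h1 in h.
  rewrite conn_sym => _; apply: (@ltri_conn _ _ t y).
    by rewrite /cyc ezx h1 h2.
  by rewrite eyx (asym zy) (asym tN) ezy h.
- case/nandP => [h|h] _ /andP[h1 h2]; last by rewrite h2 in h.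
  move=> _; apply: (@ltri_conn _ _ t y).
    by rewrite /cyc (asym zx) ezx h1 h2.
  by rewrite (asym yx) eyx ezy (negbNE h) orbT.
Qed.

End Classes.
(** * Embedded tournaments and decompositions *)

Lemma transitive_subset (T : finType) (e : rel T) m (S : {set T}) :
  is_tournament e -> 2 ^ m <= #|S| ->
  exists s : seq T, [/\ size s = m, {subset s <= S} & pairwise e s].
Proof.
move=> te; elim: m S => [|m IH] S hS; first by exists [::].
have /card_gt0P[x xS] : 0 < #|S| by apply: leq_trans hS; rewrite expn_gt0.
have hS' : 2 ^ m <= #|S :&: [set y | e x y]| \/ 2 ^ m <= #|S :&: [set y | e y x]|.
  apply/orP; rewrite -[_ || _]negbK negb_or -!ltnNge; apply/negP => /andP[h1 h2].
  have: #|S :\ x| <= #|S :&: [set y | e x y]| + #|S :&: [set y | e y x]|.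
    apply: leq_trans (leq_card_setU _ _); apply/subset_leq_card/subsetP=> y.
    rewrite !inE => /andP[yx ->] /=; rewrite (tourn_asym te yx); exact: orNb.
  have := cardsD1 x S; rewrite xS; move: hS h1 h2; rewrite expnS; lia.
case: hS' => /IH[s [sz sS ps]].
  exists (x :: s); split=> /=; rewrite ?sz //.
    by move=> y; rewrite inE => /predU1P[->|/sS] //; rewrite inE => /andP[].
  by rewrite ps andbT; apply/allP=> y /sS; rewrite !inE => /andP[].
exists (rcons s x); split; first by rewrite size_rcons sz.
  by move=> y; rewrite mem_rcons inE => /predU1P[->|/sS] //; rewrite inE => /andP[].
by rewrite pairwise_rcons ps andbT; apply/allP=> y /sS; rewrite !inE => /andP[].
Qed.

Lemma contains_one_backedge (T : finType) (e : rel T) n a b (f : 'I_n -> T) :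
  is_tournament e -> b < a ->
  (forall i j : 'I_n, i < j ->
     if (val i == b) && (val j == a) then e (f j) (f i) else e (f i) (f j)) ->
  contains e (@one_backedge n a b).
Proof.
move=> te ba H; have E i j : e (f i) (f j) = one_backedge a b i j.
  rewrite /one_backedge /=; case: (ltngtP i j) => ij.
  - have /= := H _ _ ij; case: ifP => ibja h; rewrite ?(tourn_edge te h) ?h;
    by do !case: ifP => //; lia.
  - have /= := H _ _ ij; case: ifP => jbia h; rewrite ?(tourn_edge te h) ?h;
    by do !case: ifP => //; lia.
  by rewrite (ord_inj ij) tourn_irr //; do !case: ifP => //; lia.
exists f; do !split=> //; move=> i j fij; apply/val_inj; case: (ltngtP i j) => // ij.
  by have := H _ _ ij; rewrite fij tourn_irr // if_same.
by have := H _ _ ij; rewrite fij tourn_irr // if_same.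
Qed.

(** A transitive [s] of size [n - 3] among the counted vertices gives the order [t, q, s, p], whose
    only backedge [p -> q] runs from last to second. *)
Lemma few_out_Kfree (T : finType) (e : rel T) n :
  is_tournament e -> 3 <= n -> ~ contains e (@K_t n) -> few_out e (2 ^ n).
Proof.
move=> te n3 nK t p q pq tp tq; rewrite leqNgt; apply/negP => big; apply: nK.
have [s [sz sS ps]] : exists s : seq T, [/\ size s = n - 3,
    {subset s <= [set h | [&& e q h, e h p & e t h]]} & pairwise e s].
  by apply: transitive_subset; rewrite // (leq_trans _ (ltnW big)) // leq_exp2l ?leq_subr.
have {}sS h : h \in s -> [/\ e q h, e h p & e t h].
  by move/sS; rewrite inE => /and3P.
apply: (@contains_one_backedge _ _ _ _ _ (fun i => nth t [:: t, q & rcons s p] i)) => //; first by lia.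
move=> [[|[|i]] hi] [[|[|j]] hj] //= ij.
- rewrite nth_rcons sz; case: ltnP => hj'; first by have [] := sS _ (mem_nth t (n := j) (s := s) ltac:(by rewrite sz)).
  by case: eqP => // nj; lia.
- rewrite nth_rcons sz; case: ltnP => hj'.
    rewrite ifF; last by lia.
    by have [] := sS _ (mem_nth t (n := j) (s := s) ltac:(by rewrite sz)).
  by rewrite !ifT //; lia.
have {}ps : pairwise e (rcons s p).
  by rewrite pairwise_rcons ps andbT; apply/allP=> y /sS[].
by apply: (elimT (pairwiseP t) ps); rewrite ?inE ?size_rcons ?sz; lia.
Qed.

(** Reversing both the edges and the order keeps forward edges forward and moves the backedge to the
    other end. *)
Lemma Kstar_of_rev (T : finType) (e : rel T) n :
  1 < n -> contains (rev_rel e) (@K_t n) -> contains e (@Kstar_t n).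
Proof.
move=> n1 [f [finj [_ fE]]]; exists (fun i => f (rev_ord i)); do !split=> //.
  by move=> i j /finj /rev_ord_inj.
move=> i j; have := fE (rev_ord j) (rev_ord i); rewrite /rev_rel => ->.
have := ltn_ord i; have := ltn_ord j.
by rewrite /K_t /Kstar_t /one_backedge /=; do !case: ifP => //; lia.
Qed.

Lemma few_in_Kstarfree (T : finType) (e : rel T) n :
  is_tournament e -> 3 <= n -> ~ contains e (@Kstar_t n) -> few_in e (2 ^ n).
Proof.
move=> te n3 nK; apply: (few_in_rev (e := rev_rel e)).
by apply: (few_out_Kfree (is_tournament_rev te) n3) => /(Kstar_of_rev (ltnW n3)).
Qed.

Lemma J_common_nbrs (T : finType) (e : rel T) m (f : 'I_m.+2 -> T) : injective f ->
  (forall i j, e (f i) (f j) = J_t i j) ->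
  m <= #|[set h | e (f ord0) h && e h (f ord_max)]|.
Proof.
move=> finj fE; pose g (i : 'I_m) := f (lift ord0 (lift ord_max i)).
have ginj : injective g by move=> i j /finj/lift_inj/lift_inj.
rewrite -[X in X <= _]card_ord -(card_imset predT ginj); apply/subset_leq_card/subsetP.
move=> _ /imsetP[i _ ->]; rewrite inE !fE /J_t /one_backedge /= /bump; have := ltn_ord i.
by move=> im; apply/andP; split; do !case: ifP => //; lia.
Qed.

Lemma J_cyc (T : finType) (e : rel T) k (f : 'I_k -> T) (a i b : 'I_k) :
  (forall i j, e (f i) (f j) = J_t i j) -> val a = 0 -> val b = k.-1 -> 0 < val i < k.-1 ->
  cyc e (f a) (f i) (f b).
Proof.
move=> fE a0 bk ik; rewrite /cyc !fE /J_t /one_backedge a0 bk.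
by apply/and3P; split; do !case: ifP => //; lia.
Qed.

(** * The quotient by twin classes *)

Section Decomposition.

Variables (T : finType) (e : rel T) (c : nat).
Hypotheses (te : is_tournament e) (c0 : 0 < c) (fo : few_out e c) (fi : few_in e c).
Hypothesis big : 12 * c < #|T|.

(** The ends of [J_t] lie in a common cyclic triangle, so as twins they would be connected by
    nearness; but the [36 * c + 1] inner vertices exceed the bound of [conn_edge]. *)
Lemma twin_Jfree f : injective f -> (forall i j : 'I_((36 * c).+3), e (f i) (f j) = J_t i j) ->
  exists i j, ~~ twin e (f i) (f j).
Proof.
move=> finj fE; exists ord0, ord_max; apply/negP => tw.
have C := J_cyc (a := ord0) (b := ord_max) (i := lift ord0 ord0) fE erefl erefl isT.
have ba : e (f ord_max) (f ord0) by case/and3P: C.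
case/orP: tw => [cab|/forallP/(_ (f (lift ord0 ord0)))]; last first.
  by case/andP=> _ /negP[]; case/and3P: C => *; apply/and3P.
have := conn_edge te c0 fo fi ba cab; rewrite leqNgt; case/negP.
exact: (J_common_nbrs finj fE).
Qed.

(** The choice depends only on the predicate [twin e x], so twins share it; reflexivity keeps the
    default from occurring. *)
Definition rep x := odflt x [pick y | twin e x y].

Lemma twin_rep x : twin e x (rep x).
Proof. by rewrite /rep; case: pickP => //= _; apply: twin_refl. Qed.

Lemma rep_eq x y : (rep x == rep y) = twin e x y.
Proof.
have T3 := twin_trans te c0 fo fi big; have S2 := @twin_sym _ e.
apply/eqP/idP => [E|xy].
  by apply: T3 (twin_rep x) _; rewrite E S2 twin_rep.
rewrite /rep (eq_pick (Q := twin e y)).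
  by case: pickP => //= /(_ y); rewrite twin_refl.
move=> z; apply/idP/idP => h; first by apply: T3 h; rewrite S2.
exact: T3 xy h.
Qed.

Lemma twin_congr x y x' y' : twin e x x' -> twin e y y' -> ~~ twin e x y ->
  e x y = e x' y'.
Proof.
have T3 := twin_trans te c0 fo fi big; have S2 := @twin_sym _ e.
have M := twin_module te c0 fo fi big.
move=> xx yy xy; rewrite (M y y') //; last by rewrite S2.
have xy' : ~~ twin e x y' by apply: contra xy => h; apply: T3 h _; rewrite S2.
have x'y' : ~~ twin e x' y' by apply: contra xy'; apply: T3.
have xN : y' != x by apply: contraNneq xy' => ->; apply: twin_refl.
have x'N : y' != x' by apply: contraNneq x'y' => ->; apply: twin_refl.
by rewrite (tourn_asym te xN) (tourn_asym te x'N) (M x x').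
Qed.

Lemma twin_decomp : Tr_decomp_Jfree e ((36 * c).+3).
Proof.
pose Q := {x : T | rep x == x}.
have repK x : rep (rep x) == rep x by rewrite rep_eq twin_sym twin_rep.
pose q x : Q := exist _ (rep x) (repK x).
have qK (u : Q) : q (val u) = u by apply/val_inj; exact: (eqP (valP u)).
have qE x y : (q x == q y) = twin e x y by rewrite -val_eqE /= rep_eq.
pose eQ : rel Q := fun u v => e (val u) (val v).
have eQE x y : ~~ twin e x y -> eQ (q x) (q y) = e x y.
  by move=> xy; rewrite (twin_congr (twin_rep x) (twin_rep y) xy).
have tQ : is_tournament eQ.
  split; first by have [/card_gt0P[x _] _] := te; apply/card_gt0P; exists (q x).
  split=> [u|u v uv]; first by rewrite /eQ tourn_irr.
  by have [_ [_]] := te; apply; rewrite val_eqE.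
(* Corners of a cyclic triangle of the quotient lie in distinct components of nearness, so no vertex
   has the triangle in a neighbourhood. *)
have cycQ (x y u : Q) : cyc eQ x y u -> ~~ connect (near e) (val x) (val y).
  case/and3P=> xy _ _; apply/negP => cxy.
  have : twin e (val x) (val y) by rewrite /twin cxy.
  by rewrite -qE !qK => /eqP E; move: xy; rewrite E /eQ tourn_irr.
have locO v x y u : eQ v x -> eQ v y -> eQ v u -> ~~ cyc eQ x y u.
  move=> vx vy vu; apply/negP => C; have /negP := cycQ _ _ _ C; apply.
  by apply: (ltri_conn (u := val u) (v := val v)) => //; apply/orP; left; apply/and3P.
have locI v x y u : eQ x v -> eQ y v -> eQ u v -> ~~ cyc eQ x y u.
  move=> vx vy vu; apply/negP => C; have /negP := cycQ _ _ _ C; apply.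
  by apply: (ltri_conn (u := val u) (v := val v)) => //; apply/orP; right; apply/and3P.
have edgeC x y : eQ x y -> exists z, cyc eQ x y z.
  move=> xy; have : ~~ twin e (val x) (val y).
    by rewrite -qE !qK; apply: contraTneq xy => ->; rewrite /eQ tourn_irr.
  move=> nxy; have := nxy; rewrite negb_or => /andP[_ /forallPn[z]].
  rewrite -negb_or negbK => Cz.
  have {}Cz : cyc e (val x) (val y) z.
    by case/orP: Cz => // /and3P[yx]; move: xy; rewrite /eQ => /(tourn_edge te) []; rewrite yx.
  case/and3P: Cz => _ yz zx.
  have M := twin_module te c0 fo fi big.
  have nyx : ~~ twin e (val y) (val x) by rewrite twin_sym.
  (* [z] need not be a representative. It lies in neither class, as homogeneity would then reverse
     one of its edges, so it can be replaced by its own representative. *)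
  have nyz : ~~ twin e (val y) z.
    apply: contraTN zx => yz'; have := M _ _ _ yz' nyx.
    by rewrite [e (val x) (val y)]xy => /esym h; rewrite (tourn_edge te h).
  have nzx : ~~ twin e z (val x).
    apply: contraTN yz => zx'; rewrite (M _ _ (val y) zx') 1?twin_sym //.
    by rewrite (tourn_edge te xy).
  have := eQE _ _ nyz; have := eQE _ _ nzx; rewrite !qK => zxE yzE.
  by exists (q z); rewrite /cyc xy yzE zxE yz.
have [oddQ [pos [[posV posK posVK] posE]]] := rotation_structure tQ locO locI edgeC.
have posI := can_inj posK.
exists _, (pos \o q); split=> //; split; [|split].
- by move=> i; exists (val (posV i)); rewrite /= qK posVK.
- move=> x y /=; rewrite posE => xy; rewrite -(eQE x y) // -qE.
  by apply: contraTneq xy => ->; rewrite /eQ tourn_irr.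
move=> i [f [finj [fi' fE]]]; have [a [b /negP]] := twin_Jfree finj fE; apply.
by rewrite -qE; apply/eqP/posI; exact: etrans (eqP (fi' a)) (esym (eqP (fi' b))).
Qed.

End Decomposition.

(** * Neighbourhoods in [T_r(H_1, .., H_r)] *)

Lemma Tr_edge_asym r (i j : 'I_r) : odd r -> i != j -> Tr_edge j i = ~~ Tr_edge i j.
Proof.
rewrite -val_eqE !Tr_edgeE /=; have := ltn_ord i; have := ltn_ord j.
by case: (leqP i j); case: (leqP j i); lia.
Qed.

Lemma Tr_locally_transitive_out r (v x y u : 'I_r) : odd r ->
  Tr_edge v x -> Tr_edge v y -> Tr_edge v u -> ~~ cyc (@Tr_edge r) x y u.
Proof.
rewrite /cyc !Tr_edgeE; have := (ltn_ord v, ltn_ord x, ltn_ord y, ltn_ord u).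
case=> [[[]]]; case: (leqP v x); case: (leqP v y); case: (leqP v u);
  case: (leqP x y); case: (leqP y u); case: (leqP u x); lia.
Qed.

Lemma Tr_locally_transitive_in r (v x y u : 'I_r) : odd r ->
  Tr_edge x v -> Tr_edge y v -> Tr_edge u v -> ~~ cyc (@Tr_edge r) x y u.
Proof.
rewrite /cyc !Tr_edgeE; have := (ltn_ord v, ltn_ord x, ltn_ord y, ltn_ord u).
case=> [[[]]]; case: (leqP x v); case: (leqP y v); case: (leqP u v);
  case: (leqP x y); case: (leqP y u); case: (leqP u x); lia.
Qed.

Section Blocks.

Variables (T : finType) (e : rel T) (r : nat) (p : T -> 'I_r).
Hypotheses (te : is_tournament e) (oddr : odd r).
Hypothesis pE : forall x y, Tr_edge (p x) (p y) -> e x y.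

Lemma block_edge x y : p x != p y -> Tr_edge (p x) (p y) = e x y.
Proof.
move=> pxy; apply/idP/idP; first exact: pE.
apply: contraLR; rewrite -Tr_edge_asym // => /pE /(tourn_edge te) ->.
by [].
Qed.

(** Two corners in one block force the third into it. Three distinct blocks would form a cyclic
    triangle inside a neighbourhood of [p v] in [T_r]. *)
Lemma block_cyc v x y u : cyc e x y u ->
  [&& e v x, e v y & e v u] || [&& e x v, e y v & e u v] -> p x = p y.
Proof.
move=> C; have /and3P[xy yu ux] := C.
have two a b d : e a b -> e b d -> e d a -> p a = p b -> p b = p d.
  move=> ab bd da E; apply/eqP; apply: contraT => N.
  have := block_edge N; rewrite bd -E => /pE; by rewrite (tourn_edge te da).
move=> V; apply/eqP; apply: contraT => Nxy.
have Nyu : p y != p u by apply: contraNneq Nxy => E; rewrite E (two _ _ _ yu ux xy E).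
have Nux : p u != p x by apply: contraNneq Nxy => /(two _ _ _ ux xy yu) ->.
have C' : cyc (@Tr_edge r) (p x) (p y) (p u) by rewrite /cyc !block_edge.
have out : Tr_edge (p v) (p x) -> Tr_edge (p v) (p y) -> Tr_edge (p v) (p u) -> False.
  by move=> h1 h2 h3; case/negP: (Tr_locally_transitive_out oddr h1 h2 h3).
have inn : Tr_edge (p x) (p v) -> Tr_edge (p y) (p v) -> Tr_edge (p u) (p v) -> False.
  by move=> h1 h2 h3; case/negP: (Tr_locally_transitive_in oddr h1 h2 h3).
(* In the block of a corner, [v] would have one edge into and one edge out of the triangle, like
   that corner. *)
have far a b d : e a b -> e d a -> p a != p b -> p d != p a ->
    e v b && e v d || e b v && e d v -> p v != p a.
  move=> ab da Nab Nda W; apply/eqP=> va; move: ab da; rewrite -!block_edge // -va.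
  by move=> /pE/(tourn_edge te) vb /pE/(tourn_edge te) dv; move: W; rewrite vb dv andbF.
have vx : p v != p x by apply: (far _ _ _ xy ux Nxy Nux); case/orP: V => /and3P[Vx Vy Vu]; rewrite ?Vx ?Vy ?Vu ?orbT.
have vy : p v != p y by apply: (far _ _ _ yu xy Nyu Nxy); case/orP: V => /and3P[Vx Vy Vu]; rewrite ?Vx ?Vy ?Vu ?orbT.
have vu : p v != p u by apply: (far _ _ _ ux yu Nux Nyu); case/orP: V => /and3P[Vx Vy Vu]; rewrite ?Vx ?Vy ?Vu ?orbT.
by case/orP: V => /and3P[Vx Vy Vu]; [case: out | case: inn]; rewrite block_edge // eq_sym.
Qed.

(** Each inner vertex of [J_t] forms a cyclic triangle with the two ends, so all vertices share the
    block of the first. *)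
Lemma block_Jfree k v (f : 'I_k -> T) : 3 <= k -> injective f ->
  (forall i j, e (f i) (f j) = J_t i j) ->
  (forall i, e v (f i)) \/ (forall i, e (f i) v) ->
  exists i, contains_in e (fun x => p x == i) (@J_t k).
Proof.
case: k f => [|[|[|m]]] // f _ finj fE V.
have C i : 0 < val i < m.+2 -> cyc e (f ord0) (f i) (f ord_max).
  exact: (J_cyc (a := ord0) (b := ord_max) fE).
have B a b d : cyc e (f a) (f b) (f d) -> p (f a) = p (f b).
  move=> Cabd; apply: (block_cyc (v := v) Cabd).
  by case: V => V; rewrite !V ?orbT.
exists (p (f ord0)), f; split=> //; split=> // i; apply/eqP.
case: (posnP i) => [i0|i0]; first by congr (p (f _)); apply/val_inj.
have := ltn_ord i; rewrite ltnS leq_eqVlt => /predU1P[im|im].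
  rewrite (_ : i = ord_max); last exact/val_inj.
  apply: (B _ _ (lift ord0 ord0)); have := C (lift ord0 ord0) isT.
  by rewrite /cyc => /and3P[-> -> ->].
by apply/esym/(B _ _ ord_max)/C; rewrite i0.
Qed.

End Blocks.

(** The first vertex of [K_t k.+1] dominates a copy of [J_t k] formed by the others; in
    [Kstar_t k.+1] the last vertex is dominated by such a copy. *)
Lemma Tr_decomp_Kfree (T : finType) (e : rel T) k : 3 <= k ->
  is_tournament e -> Tr_decomp_Jfree e k ->
  ~ contains e (@K_t k.+1) /\ ~ contains e (@Kstar_t k.+1).
Proof.
move=> k3 te [r [p [oddr [_ [pE Jfree]]]]].
split=> -[f [finj [_ fE]]].
  have [|||i] := @block_Jfree _ _ _ p te oddr pE k (f ord0) (f \o lift ord0) k3.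
  - by move=> i j /finj/lift_inj.
  - move=> i j; rewrite /= fE /K_t /J_t /one_backedge /= /bump.
    have := ltn_ord i; have := ltn_ord j; do !case: ifP => //; lia.
  - left=> i; rewrite fE /K_t /one_backedge /= /bump; have := ltn_ord i; do !case: ifP => //; lia.
  exact: Jfree.
have [|||i] := @block_Jfree _ _ _ p te oddr pE k (f ord_max) (f \o lift ord_max) k3.
- by move=> i j /finj/lift_inj.
- move=> i j; rewrite /= fE /Kstar_t /J_t /one_backedge /= /bump.
  have := ltn_ord i; have := ltn_ord j; do !case: ifP => //; lia.
- right=> i; rewrite fE /Kstar_t /one_backedge /= /bump; have := ltn_ord i; do !case: ifP => //; lia.
exact: Jfree.
Qed.

Lemma K_free_decomp (T : finType) (e : rel T) n : 3 <= n -> is_tournament e ->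
  ~ contains e (@K_t n) -> ~ contains e (@Kstar_t n) ->
  Tr_decomp_Jfree e (36 * 2 ^ n).+3.
Proof.
move=> n3 te nK nKs; have c0 : 0 < 2 ^ n by rewrite expn_gt0.
case: (ltnP (12 * 2 ^ n) #|T|) => [big|small].
  exact: twin_decomp te c0 (few_out_Kfree te n3 nK) (few_in_Kstarfree te n3 nKs) big.
(* One block suffices here, as the forbidden [J_t] has more vertices than [T]. *)
exists 1, (fun=> ord0); split=> //; split; [|split=> //].
- by move=> i; have [/card_gt0P[x _] _] := te; exists x; rewrite ord1.
move=> i [f [finj _]]; have := leq_card f finj; rewrite card_ord => le_k.
by move: (leq_trans le_k small); lia.
Qed.

Theorem theorem6p2 :
  (forall n : nat, 3 <= n ->
     exists k : nat, 3 <= k /\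
       forall (T : finType) (e : rel T), is_tournament e ->
         ~ contains e (@K_t n) -> ~ contains e (@Kstar_t n) ->
         Tr_decomp_Jfree e k)
  /\
  (forall k : nat, 3 <= k ->
     exists n : nat, 3 <= n /\
       forall (T : finType) (e : rel T), is_tournament e ->
         Tr_decomp_Jfree e k ->
         ~ contains e (@K_t n) /\ ~ contains e (@Kstar_t n)).
Proof.
split=> [n n3|k k3].
  by exists (36 * 2 ^ n).+3; split=> // T e; apply: K_free_decomp.
by exists k.+1; split=> [|T e]; [apply: ltnW | apply: Tr_decomp_Kfree].
Qed.
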